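(* Let $N\ge 1$ and $M\ge 0$ be integers and let $\boldsymbol{\phi}=(\phi_1,\ldots,\phi_N)$ be a collection of functions in $L_2(\mathbb{R})$. If the integer-shift-invariant space $\mathrm{S}(\boldsymbol{\phi})$ reproduces polynomials of degree up to $M$, then $|\boldsymbol{\phi}|\ge M+1$. In addition, if $|\boldsymbol{\phi}|=M+1$, then $$\sum_{k\in\mathbb{Z}}\sum_{n=1}^N \mathbf{1}_{\mathrm{supp}(\phi_n)}(x+k)=|\boldsymbol{\phi}|\quad\text{for almost every }x\in\mathbb{R}.$$
   Context: $\mathrm{S}(\boldsymbol{\phi})=\mathrm{S}(\phi_1)+\cdots+\mathrm{S}(\phi_N)$, where $\mathrm{S}(\phi_n)$ is the closed linear span in $L_2(\mathbb{R})$ of $\{\phi_n(\cdot-k):k\in\mathbb{Z}\}$. Reproduction of polynomials: ''$\mathrm{S}(\boldsymbol{\phi})$ reproduces polynomials of degree up to $M$'' means that for every $m=0,1,\ldots,M$ there exist scalar sequences $c_{m,1},\ldots,c_{m,N}$ on $\mathbb{Z}$ (not necessarily in $\ell_2$) such that for all $x\in\mathbb{R}$, $x^m=\sum_{k\in\mathbb{Z}}\sum_{n=1}^N c_{m,n}[k]\,\phi_n(x-k)$, with the convention $x^0=1$ for all $x$. Support: $\mathrm{supp}(f)=\overline{\{x\in\mathbb{R}:f(x)\ne0\}}$. If $\mathrm{supp}(f)$ is compact, the support size is $|f|=\int_{\mathbb{R}}\mathbf{1}_{\mathrm{supp}(f)}(t)\,dt$ (the Lebesgue measure of the support); if it is not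 compact, $|f|=+\infty$. For a collection, $|\boldsymbol{\phi}|=\sum_{n=1}^N|\phi_n|$. $\mathbf{1}_E$ is the indicator function of $E$. *)

(* Defs.v *)
From HB Require Import structures.
From mathcomp Require Import all_boot all_order all_algebra.
From mathcomp Require Export complex.
From mathcomp Require Import all_classical all_reals all_analysis.
Import Order.TTheory GRing.Theory Num.Theory.
Import numFieldNormedType.Exports.

Set Implicit Arguments.
Unset Strict Implicit.
Unset Printing Implicit Defensive.

Local Open Scope classical_set_scope.
Local Open Scope ring_scope.
Local Open Scope complex_scope.

(* Functions are complex-valued and the scalars are complex; real-valued
   functions with real scalars are the special case of vanishing imaginary
   parts. Elements of L_2 are represented by actual functions R -> R[i]
   (not classes modulo a.e. equality), as supports and the pointwise
   reproduction of polynomials depend on the representative. *)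

(* R with the sigma-algebra of Lebesgue measurable sets: the Borel
   sigma-algebra would exclude some representatives of L_2 classes. *)
Definition lebesgueType (R : realType) :=
  caratheodory_type ((@wlength R idfun)^*)%mu.

Definition in_L2 (R : realType) (f : R -> R[i]) : Prop :=
  [/\ measurable_fun [set: lebesgueType R] (fun t : lebesgueType R => complex.Re (f t)),
      measurable_fun [set: lebesgueType R] (fun t : lebesgueType R => complex.Im (f t)) &
      ('N[@completed_lebesgue_measure R]_2%:E
         [EFin \o @Normc.normc R \o f] < +oo)%E].

(* Convergence of the two-sided series \sum_(k in Z) a k to s: the partial
   sums over - p <= k <= q converge to s as p and q tend to infinity
   independently. R[i]^o carries the topology of the complex modulus. *)
Definition bilateral_sum_to (R : realType) (a : int -> R[i]) (s : R[i]) : Prop :=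
  (\sum_(j < (pq.1 + pq.2).+1) a (j%:Z - pq.1%:Z)) @[pq --> filter_prod \oo \oo]
    --> (s : R[i]^o).

Definition reproduces_polynomials (R : realType) (N : nat)
    (phi : 'I_N -> R -> R[i]) (M : nat) : Prop :=
  forall m : nat, (m <= M)%N ->
  exists c : 'I_N -> int -> R[i], forall x : R,
    bilateral_sum_to
      (fun k : int => \sum_(n < N) c n k * phi n (x - k%:~R))
      ((x ^+ m)%:C).

Definition supp (R : realType) (f : R -> R[i]) : set R :=
  closure [set x | f x != 0].

Definition support_size (R : realType) (f : R -> R[i]) : \bar R :=
  if `[< compact (supp f) >]
  then (\int[lebesgue_measure]_(t in [set: R]) (\1_(supp f) t)%:E)%E
  else +oo%E.

Definition total_support_size (R : realType) (N : nat)
    (phi : 'I_N -> R -> R[i]) : \bar R :=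
  (\sum_(n < N) support_size (phi n))%E.

(* Main.v *)
Require Import Defs.
From HB Require Import structures.
From mathcomp Require Import all_boot all_order all_algebra.
From mathcomp Require Import all_classical all_reals all_analysis.
From mathcomp Require Import measurable_realfun.
From mathcomp Require Import zify lra.

Set Implicit Arguments.
Unset Strict Implicit.
Unset Printing Implicit Defensive.

Import Order.TTheory GRing.Theory Num.Theory.
Import numFieldNormedType.Exports.
Local Open Scope classical_set_scope.
Local Open Scope ring_scope.
Local Open Scope complex_scope.

(** If some support is not compact, the total support size is infinite and both
claims are trivial. Otherwise all supports lie in some [-B, B], and the theorem
follows from a pointwise statement about the covering number of x, that is the
number of pairs (n, k) with x + k in the support of phi_n: it is at least M + 1
for all but countably many real x ([countable_covering_lt]).

To see this, restrict to |x| <= r. Only finitely many pairs (n, k) can then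
satisfy x - k in supp phi_n, so the set I(x) of these active pairs takes
finitely many values, and the reproduction formula becomes the finite sum
x^m = sum over (n, k) in I(x) of c_{m,n}[k] phi_n(x - k). On a set of points
where I(x) is constantly equal to I, the M + 1 functions 1, x, ..., x^M are thus
combinations of the #|I| functions phi_n(. - k) with coefficients independent of
x. If that set has M + 1 distinct points, the Vandermonde matrix at these points
has rank M + 1 and factors through a space of dimension #|I|, so that
M + 1 <= #|I| ([card_ge_of_monomials]). Hence at most M points have I(x) = I when
#|I| <= M, and there are finitely many such I for each r.

Since the translates by integers of [a, a + 1[ tile the line, the integral of
the covering number over [a, a + 1[ is the total support size
([integral_covering]). It is therefore at least M + 1; and if it equals M + 1, a
function that is at least M + 1 almost everywhere has integral M + 1 over a set
of measure 1, so it equals M + 1 almost everywhere on that set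
([integral_eq_cst_negligible]). *)

(** * Linear algebra *)

(** A lower bound for the number of functions [g t] needed to express the
monomials of degree less than [d] at [d] distinct points. *)
Lemma card_ge_of_monomials (F : fieldType) (T : finType) (d : nat)
    (x : 'I_d -> F) (I : {set T}) (c : 'I_d -> T -> F) (g : T -> 'I_d -> F) :
  injective x ->
  (forall m i : 'I_d, x i ^+ m = \sum_(t in I) c m t * g t i) ->
  (d <= #|I|)%N.
Proof.
move=> xinj E.
(* V is the product of a d x #|I| matrix and a #|I| x d matrix. *)
pose V := Vandermonde d (\row_i x i).
have VE : V = (\matrix_(m < d, k < #|I|) c m (enum_val k)) *m
              (\matrix_(k < #|I|, i < d) g (enum_val k) i).
  apply/matrixP => m i; rewrite !mxE E big_enum_val.
  by apply: eq_bigr => k _; rewrite !mxE.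
have Vu : V \in unitmx.
  rewrite unitmxE unitfE det_Vandermonde.
  apply/prodf_neq0 => i _; apply/prodf_neq0 => j ij.
  rewrite !mxE subr_eq0; apply: contraTneq ij => /xinj ->.
  by rewrite ltnn.
by rewrite -(mxrank_unit Vu) VE mulmx_max_rank.
Qed.

(** * Two-sided series with finitely many nonzero terms *)

Lemma bilateral_partial_sum_stable (V : nmodType) (a : int -> V) (B p q : nat) :
  (forall k : int, (B%:Z < `|k|) -> a k = 0) ->
  (B <= p)%N -> (B <= q)%N ->
  \sum_(j < (p + q).+1) a (j%:Z - p%:Z) =
  \sum_(j < (B + B).+1) a (j%:Z - B%:Z).
Proof.
move=> a0 /subnK <-; elim: (p - B)%N => [|p' IH] Bq.
  rewrite add0n; move: Bq => /subnK <-; elim: (q - B)%N => [//|q' IH].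
  rewrite addSn addnS big_ord_recr /= IH a0 ?addr0//; lia.
rewrite addSn big_ord_recl /= a0 ?add0r; last lia.
rewrite -[RHS](IH Bq); apply: eq_bigr => j _; congr a.
by rewrite /bump /= add1n !intS opprD addrACA subrr add0r.
Qed.

Lemma bilateral_sum_to_finite (R : realType) (a : int -> R[i]) (s : R[i]) (B : nat) :
  (forall k : int, (B%:Z < `|k|) -> a k = 0) ->
  bilateral_sum_to a s ->
  s = \sum_(j < (B + B).+1) a (j%:Z - B%:Z).
Proof.
move=> a0 as_.
apply: (@cvg_unique R[i]^o (@norm_hausdorff _ _) _ _ _ _ as_).
apply: cvg_near_cst.
exists ([set p | (B <= p)%N], [set q | (B <= q)%N]) => /=.
  by split; exact: nbhs_infty_ge.
by move=> [p q] [/= Bp Bq]; apply: bilateral_partial_sum_stable.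
Qed.

(** * The covering number *)

(** The number, possibly infinite, of pairs [(n, k)] such that [x + k] lies in
[A n]. *)
Definition covering (R : realType) (N : nat) (A : 'I_N -> set R) (x : R) : \bar R :=
  (\esum_(k in [set: int]) (\sum_(n < N) (\1_(A n) (x + k%:~R))%:E))%E.

Lemma sum_fin_le_esum (R : realType) (S : finType) (T : choiceType)
    (e : S -> T) (g : T -> \bar R) :
  injective e -> (forall k, 0 <= g k)%E ->
  (\sum_j g (e j) <= \esum_(k in [set: T]) g k)%E.
Proof.
move=> einj g0; apply: esum_ge; exists [set` map e (index_enum S)].
  by split => //; exact: finite_seq.
by rewrite -fsbig_seq ?map_inj_uniq ?index_enum_uniq// big_map.
Qed.

(** * Integral of the covering number over a unit interval *)

Lemma measurable_translate (R : realType) (t : R) :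
  measurable_fun [set: measurableTypeR R]
    (fun x : measurableTypeR R => x + t : measurableTypeR R).
Proof. exact: measurable_funD. Qed.

Lemma lebesgue_measure_translate (R : realType) (t : R)
    (A : set (measurableTypeR R)) : measurable A ->
  lebesgue_measure ((fun x : R => x + t) @^-1` A) = lebesgue_measure A.
Proof.
move=> mA.
have mt := measurable_translate t.
rewrite -[LHS]/(pushforward lebesgue_measure
  (fun x : measurableTypeR R => x + t : measurableTypeR R) A).
symmetry; apply: lebesgue_measure_unique => //.
move=> _ [[a b] _ <-] /=.
rewrite /pushforward.
have -> : (fun x : R => x + t) @^-1` `]a, b] = `](a - t), (b - t)]%classic.
  by apply/seteqP; split => x /=; rewrite !in_itv/= ltrBlDr lerBrDr.
rewrite !lebesgue_measure_itv /= !lte_fin ltrD2r.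
by case: ifP => // _; rewrite -!EFinB; congr EFin; lra.
Qed.

Lemma nat_int_bij : exists e : nat -> int, set_bij [set: nat] [set: int] e.
Proof.
exists (fun n => if odd n then Negz n./2 else Posz n./2); split => //.
  move=> m n _ _; move: (odd_double_half m) (odd_double_half n).
  by case: (odd m); case: (odd n) => //= mE nE [mn]; rewrite -mE -nE mn.
case=> n _ /=.
  by exists n.*2; rewrite // odd_double doubleK.
by exists n.*2.+1; rewrite //= odd_double /= uphalf_double.
Qed.

(** Enumerating the integers turns the covering number into a series indexed by
the natural numbers, to which monotone convergence applies. *)
Lemma coveringE (R : realType) (N : nat) (A : 'I_N -> set R) (e : nat -> int) :
  set_bij [set: nat] [set: int] e ->
  covering A =
  (fun x => \sum_(i <oo) \sum_(n < N) (\1_(A n) (x + (e i)%:~R))%:E)%E.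
Proof.
move=> ebij; apply/funext => x; rewrite /covering (reindex_esum _ _ _ _ ebij).
by rewrite nneseries_esumT// => i; apply: sume_ge0 => n _; rewrite lee_fin.
Qed.

Section covering_measure.
Context (R : realType) (N : nat) (A : 'I_N -> set (measurableTypeR R)).
Hypothesis mA : forall n, measurable (A n).

Lemma measurable_indic_translate (B : set (measurableTypeR R)) (t : R) :
  measurable B ->
  measurable_fun [set: measurableTypeR R]
    (fun x : measurableTypeR R => (\1_B (x + t))%:E : \bar R).
Proof.
move=> mB; apply/measurable_EFinP.
have mI : measurable_fun [set: measurableTypeR R] (\1_B : _ -> R).
  exact: measurable_indic.
exact: (measurableT_comp mI (measurable_translate t)).
Qed.

Lemma measurable_covering :
  measurable_fun [set: measurableTypeR R] (covering A).
Proof.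
have [e ebij] := nat_int_bij.
rewrite (coveringE A ebij); apply: ge0_emeasurable_sum => [i x _ _|i _].
  by apply: sume_ge0 => n _; rewrite lee_fin.
by apply: emeasurable_sum => n; exact: measurable_indic_translate.
Qed.

(** The contribution of the shift [k] is the measure of the part of [A n] in
the unit interval starting at [a + k], and these intervals partition the line. *)
Lemma integral_covering (a : R) :
  (\int[@lebesgue_measure R]_(x in `[a, (a + 1)%R[) covering A x =
   \sum_(n < N) lebesgue_measure (A n))%E.
Proof.
have [e ebij] := nat_int_bij.
have mD : measurable (`[a, a + 1[ : set (measurableTypeR R)) by [].
rewrite (coveringE A ebij) integral_nneseries//; last 2 first.
- move=> i; apply: measurable_funTS; apply: emeasurable_sum => n.
  exact: measurable_indic_translate.
- by move=> i x _; apply: sume_ge0 => n _; rewrite lee_fin.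
transitivity (\sum_(i <oo) \sum_(n < N)
    lebesgue_measure (A n `&` `[(a + (e i)%:~R)%R, (a + (e i)%:~R + 1)%R[))%E.
  apply: eq_eseriesr => i _.
  rewrite ge0_integral_sum//; last first.
    by move=> n; apply: measurable_funTS; exact: measurable_indic_translate.
  apply: eq_bigr => n _.
  rewrite -(@lebesgue_measure_translate _ (e i)%:~R (_ `&` _)); last first.
    exact: measurableI.
  have -> : (fun x : R => x + (e i)%:~R) @^-1`
      (A n `&` `[a + (e i)%:~R, a + (e i)%:~R + 1[) =
      ((fun x : R => x + (e i)%:~R) @^-1` A n) `&` `[a, a + 1[.
    rewrite preimage_setI; congr (_ `&` _).
    by apply/seteqP; split => x /=; rewrite !in_itv/=; lra.
  rewrite -integral_indic//.
  by rewrite -[X in measurable X]setTI; exact: measurable_translate.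
rewrite nneseries_sum//; apply: eq_bigr => n _.
rewrite -[in RHS](setIT (A n)).
have -> : [set: R] = \bigcup_i `[a + (e i)%:~R, a + (e i)%:~R + 1[%classic.
  apply/seteqP; split => // x _.
  have [_ _ /(_ (Num.floor (x - a)) I) [i _ ei]] := ebij.
  exists i => //=; rewrite in_itv/= ei.
  have := floor_itv (x - a); rewrite intrD; lra.
rewrite setI_bigcupr measure_bigcup//.
- by apply: eq_eseriesl => i; rewrite in_setT.
- by move=> i _; exact: measurableI.
apply: trivIset_setIl; apply/trivIsetP => i j _ _ ij.
apply/seteqP; split => // x [] /=; rewrite !in_itv/= => /andP[i1 i2] /andP[j1 j2].
have [_ einj _] := ebij.
apply: (negP ij); apply/eqP; apply: einj; rewrite ?inE//.
have H1 : (e i < e j + 1)%R by rewrite -(ltr_int R) intrD; lra.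
have H2 : (e j < e i + 1)%R by rewrite -(ltr_int R) intrD; lra.
lia.
Qed.

End covering_measure.

(** * Functions bounded below by a constant almost everywhere *)

Section integral_ge_cst.
Context d (T : measurableType d) (R : realType).
Variables (mu : {measure set T -> \bar R}) (D E : set T).
Variables (f : T -> \bar R) (c : R).
Hypotheses (mD : measurable D) (mE : measurable E).
Hypotheses (muE : mu E = 0%E) (muD : mu D = 1%E).
Hypotheses (mf : measurable_fun D f) (f0 : forall x, D x -> (0 <= f x)%E).
Hypotheses (c0 : 0 <= c) (cf : forall x, (D `\` E) x -> (c%:E <= f x)%E).

Let mDE : measurable (D `\` E). Proof. exact: measurableD. Qed.

Let mg : measurable_fun (D `\` E) (fun x => f x - c%:E)%E.
Proof.
apply: emeasurable_funB => //.
by apply: measurable_funS mf => //; exact: subDsetl.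
Qed.

Let g0 x : (D `\` E) x -> (0 <= f x - c%:E)%E.
Proof. by move=> /cf; rewrite sube_ge0. Qed.

(* Since D has measure 1, the constant c contributes exactly c. *)
Let integral_excess :
  (\int[mu]_(x in D) f x = \int[mu]_(x in D `\` E) (f x - c%:E) + c%:E)%E.
Proof.
rewrite (ge0_negligible_integral mE mD mf f0 muE).
transitivity (\int[mu]_(x in D `\` E) ((f x - c%:E) + cst c%:E x))%E.
  by apply: eq_integral => x _; rewrite /cst subeK.
rewrite ge0_integralD//; congr (_ + _)%E.
rewrite -(@ge0_negligible_integral _ _ _ mu D E (cst c%:E))//.
by rewrite integral_cst// muD mule1.
Qed.

Lemma cst_le_integral : (c%:E <= \int[mu]_(x in D) f x)%E.
Proof. by rewrite integral_excess leeDr// integral_ge0. Qed.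

Lemma integral_eq_cst_negligible : (\int[mu]_(x in D) f x = c%:E)%E ->
  mu.-negligible (D `&` [set x | f x <> c%:E]).
Proof.
rewrite integral_excess => gc.
have {}gc : (\int[mu]_(x in D `\` E) `|f x - c%:E| = 0)%E.
  transitivity (\int[mu]_(x in D `\` E) (f x - c%:E))%E.
    by apply: eq_integral => x; rewrite inE => /g0 ?; rewrite gee0_abs.
  by move/(congr1 (fun z => z - c%:E)%E): gc; rewrite addeK// subee.
have /ae_eq_integral_abs : measurable_fun (D `\` E) (fun x => f x - c%:E)%E by [].
move=> /(_ mu mDE) [/(_ gc) + _].
move=> nD.
have nE : mu.-negligible E by exists E; split.
apply: negligibleS (negligibleU nD nE) => x /= [Dx fc].
have [xE|xE] := pselect (E x); [by right|left] => /= H.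
by apply: fc; rewrite -[LHS](@subeK _ _ c%:E)// H// add0e.
Qed.

End integral_ge_cst.

(** * Lower bound for the covering number of the supports *)

Section reproduction.
Context (R : realType) (N M : nat) (phi : 'I_N -> R -> R[i]).
Hypothesis hrep : reproduces_polynomials phi M.
Variable B : nat.
Hypothesis suppB : forall n x, supp (phi n) x -> `|x| <= B%:R.

Let A n := supp (phi n).

Lemma phi_notin_supp n x : x \notin supp (phi n) -> phi n x = 0.
Proof.
apply: contraNeq => phix; rewrite inE; exact: subset_closure.
Qed.

Section window.
(* Only the shifts k with |k| <= P are considered. *)
Variable P : nat.

(** The indices [0, ..., 2 P] encode the shifts [- P, ..., P]. *)
Definition shift_of (j : 'I_(P + P).+1) : int := j%:Z - P%:Z.

(** The pairs [(n, j)] for which [x - k], with [k] the shift encoded by [j], lies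
in the support of [phi n]. *)
Definition active (x : R) : {set 'I_N * 'I_(P + P).+1} :=
  [set t | x - (shift_of t.2)%:~R \in A t.1].

(** The sign differs between the two sides: [active] uses [x - k] as the
reproduction formula does, [covering] uses [x + k]. *)
Lemma card_active_le_covering x : (#|active x|%:R%:E <= covering A x)%E.
Proof.
pose e (j : 'I_(P + P).+1) : int := - shift_of j.
have einj : injective e.
  by move=> i j /oppr_inj /addIr [] /ord_inj.
apply: le_trans (sum_fin_le_esum (e := e)
  (g := fun k => \sum_(n < N) (\1_(A n) (x + k%:~R))%:E)%E einj _); last first.
  by move=> k; apply: sume_ge0 => n _; rewrite lee_fin.
under eq_bigr do rewrite sumEFin; rewrite sumEFin lee_fin.
rewrite exchange_big pair_big /= -sum1_card natr_sum big_mkcond /=.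
apply: ler_sum => t _; rewrite inE /e /= rmorphN /= indicE.
by case: ifP.
Qed.

Variable c : nat -> 'I_N -> int -> R[i].
Hypothesis hc : forall m, (m <= M)%N -> forall x : R,
  bilateral_sum_to
      (fun k : int => \sum_(n < N) c m n k * phi n (x - k%:~R))
      ((x ^+ m)%:C).

(** For |x| <= r, every shift [k] with [x - k] in a support satisfies
|k| <= B + r <= P, so the reproduction formula involves active pairs only. *)
Lemma monomial_active (r m : nat) (x : R) : (B + r <= P)%N -> (m <= M)%N ->
  `|x| <= r%:R ->
  (x%:C) ^+ m = \sum_(t in active x)
    c m t.1 (shift_of t.2) * phi t.1 (x - (shift_of t.2)%:~R).
Proof.
move=> BrP mM xr; rewrite -rmorphXn /=.
rewrite (@bilateral_sum_to_finite _ _ _ P _ (@hc m mM x)); last first.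
  move=> k Pk; apply: big1 => n _.
  rewrite phi_notin_supp ?mulr0//; apply/negP; rewrite inE => /suppB.
  have : (P%:R < `|k%:~R| :> R) by rewrite -intr_norm -[P%:R]/(P%:Z%:~R) ltr_int.
  have : ((B + r)%:R <= P%:R :> R) by rewrite ler_nat.
  have := ler_normB x (x - k%:~R).
  rewrite subKr natrD; lra.
rewrite exchange_big pair_big /= [RHS]big_mkcond /=.
apply: eq_bigr => t _; case: ifPn => //.
by rewrite inE => /phi_notin_supp ->; rewrite mulr0.
Qed.

(** By [card_ge_of_monomials], M + 1 distinct points of this set would force
[M < #|I|]. *)
Lemma finite_few_active (r : nat) (I : {set 'I_N * 'I_(P + P).+1}) :
  (B + r <= P)%N -> (#|I| <= M)%N ->
  finite_set [set x | `|x| <= r%:R /\ active x = I].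
Proof.
move=> BrP IM; apply: contrapT => /infiniteP/pcard_leP[f].
move: IM; rewrite leqNgt => /negP; apply.
pose x (i : 'I_M.+1) := f i.
apply: (@card_ge_of_monomials _ _ _ (fun i => (x i)%:C) _
  (fun m t => c m t.1 (shift_of t.2))
  (fun t i => phi t.1 (x i - (shift_of t.2)%:~R))).
  move=> i j /complexI /inj H; apply/ord_inj; apply: H; by rewrite inE.
move=> m i; have [xr <-] : [set x | `|x| <= r%:R /\ active x = I] (x i).
  exact: funS.
by apply: (monomial_active BrP) => //; rewrite -ltnS.
Qed.

End window.

Lemma countable_covering_lt :
  countable [set x | (covering A x < M.+1%:R%:E)%E].
Proof.
have [c hc] : exists c : nat -> 'I_N -> int -> R[i], forall m, (m <= M)%N ->
    forall x : R, bilateral_sum_to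
      (fun k : int => \sum_(n < N) c m n k * phi n (x - k%:~R)) ((x ^+ m)%:C).
  suff /choice [c hc] : forall m, exists c : 'I_N -> int -> R[i], (m <= M)%N ->
    forall x : R, bilateral_sum_to
      (fun k : int => \sum_(n < N) c n k * phi n (x - k%:~R)) ((x ^+ m)%:C).
    by exists c.
  move=> m; case: (leqP m M) => [/hrep[c ?]|_]; first by exists c.
  by exists (fun _ _ => 0).
pose F r := \bigcup_(I in [set I : {set 'I_N * 'I_((B + r) + (B + r)).+1} |
  (#|I| <= M)%N]) [set x | `|x| <= r%:R /\ active (B + r) x = I].
apply: (@sub_countable _ _ _ (\bigcup_r F r)).
  apply: subset_card_le => x /= xM.
  have [r xr] : exists r : nat, `|x| <= r%:R.
    by exists (Num.bound `|x|); apply/ltW/archi_boundP.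
  exists r => //; exists (active (B + r) x) => //=.
  rewrite -ltnS -(ltr_nat R) -lte_fin.
  exact: le_lt_trans (card_active_le_covering _ _) xM.
apply: bigcup_countable => // r _.
apply: finite_set_countable; apply: bigcup_finite; first exact: finite_finset.
by move=> I /= IM; exact: (finite_few_active hc).
Qed.

End reproduction.

(** * Support sizes *)

Lemma support_size_ge0 (R : realType) (f : R -> R[i]) : (0 <= support_size f)%E.
Proof.
by rewrite /support_size; case: ifP => // _; apply: integral_ge0 => x _; rewrite lee_fin.
Qed.

Lemma support_size_compact (R : realType) (f : R -> R[i]) :
  compact (supp f) -> support_size f = lebesgue_measure (supp f).
Proof.
move=> K; rewrite /support_size asboolT// integral_indic ?setIT//.
exact: closed_measurable (@closed_closure _ _).
Qed.

Lemma compact_norm_bound (R : realType) (K : set R) :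
  compact K -> exists b : nat, forall x, K x -> `|x| <= b%:R.
Proof.
move=> /compact_bounded[b [_ hb]].
exists (Num.bound `|b|) => x Kx; apply: (hb (Num.bound `|b|)%:R) => //.
exact: le_lt_trans (ler_norm b) (archi_boundP _).
Qed.

Unset Implicit Arguments.

Theorem theorem1 (R : realType) (N M : nat) (hN : (1 <= N)%N)
    (phi : 'I_N -> R -> R[i])
    (hL2 : forall n : 'I_N, in_L2 (phi n))
    (hrep : reproduces_polynomials phi M) :
  (M.+1%:R%:E <= total_support_size phi)%E /\
  (total_support_size phi = M.+1%:R%:E ->
   {ae lebesgue_measure, forall x : R,
     (\esum_(k in [set: int])
        (\sum_(n < N) (\1_(supp (phi n)) (x + k%:~R))%:E)%E)
     = total_support_size phi}).
Proof.
have [cpt|] := pselect (forall n, compact (supp (phi n))); last first.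
  move=> /existsNP[n ncpt].
  suff -> : total_support_size phi = +oo%E by rewrite leey.
  rewrite /total_support_size (bigD1 n)//= {1}/support_size asboolF// addye//.
  by rewrite -ltNye (lt_le_trans ltNy0)// sume_ge0// => *; exact: support_size_ge0.
have [b hb] := choice (fun n => compact_norm_bound (cpt n)).
pose B := (\max_(n < N) b n)%N.
have hB n x : supp (phi n) x -> `|x| <= B%:R.
  by move=> /hb /le_trans; apply; rewrite ler_nat; exact: leq_bigmax.
pose A n : set (measurableTypeR R) := supp (phi n).
have mA n : measurable (A n) by exact: closed_measurable (@closed_closure _ _).
have SE : total_support_size phi = (\sum_(n < N) lebesgue_measure (A n))%E.
  by apply: eq_bigr => n _; exact: support_size_compact.
pose E : set (measurableTypeR R) := [set x | (covering A x < M.+1%:R%:E)%E].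
have cE : countable E by exact: (countable_covering_lt hrep hB).
have mE : measurable E.
  by apply: countable_measurable cE => t; exact: measurable_set1.
have muE : lebesgue_measure E = 0%E by exact: countable_lebesgue_measure0.
pose D (a : R) : set (measurableTypeR R) := `[a, a + 1[%classic.
have mD a : measurable (D a) by exact: measurable_itv.
have muD a : lebesgue_measure (D a) = 1%E.
  by rewrite lebesgue_measure_itv/= lte_fin ltrDl ltr01 -EFinB addrAC subrr add0r.
have mcov a : measurable_fun (D a) (covering A).
  by apply: measurable_funTS; exact: measurable_covering.
have cov0 a x : D a x -> (0 <= covering A x)%E.
  by move=> _; apply: esum_ge0 => k _; apply: sume_ge0 => n _; rewrite lee_fin.
have covE a x : (D a `\` E) x -> (M.+1%:R%:E <= covering A x)%E.
  by move=> [_ /negP]; rewrite -leNgt.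
split.
  rewrite SE -(integral_covering mA 0).
  exact: (cst_le_integral (mD 0) mE muE (muD 0) (mcov 0) (@cov0 0) _ (@covE 0)).
move=> SM; rewrite SM.
have neg a : lebesgue_measure.-negligible (D a `&` [set x | covering A x <> M.+1%:R%:E]).
  apply: (integral_eq_cst_negligible (mD a) mE muE (muD a) (mcov a)
    (@cov0 a) _ (@covE a)) => //.
  by rewrite -SM SE; exact: integral_covering.
(* The unit intervals starting at the integers cover the line. *)
have [e [_ _ esurj]] := nat_int_bij.
apply: negligibleS (negligible_bigcup (fun i => neg (e i)%:~R)) => x /= xM.
have [i _ ei] := esurj (Num.floor x) I.
exists i => //; split => //=; rewrite /D /= in_itv/= ei.
by have := floor_itv x; rewrite intrD.
Qed.
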